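(* Let $a,c$ be nonzero complex numbers and let $\ell,m,n$ be nonnegative integers with $m\le n$. Then $$ {}_4\phi_3\left[\begin{matrix}a,\,q^{1-\ell}/a,\,q^{-n},\,-q^{m-n}\\ c,\,q^{1-\ell+m-2n}/c,\,-q\end{matrix};q,q\right] =\frac{(a,\,q^{\ell-1}ac;q)_\ell}{(c,\,q^{\ell-1}a^2;q)_\ell}\, \frac{(q^{1-m+n},\,-q^{\ell}c;q)_n}{(q^{n-m+\ell}c,\,-q;q)_n}\sum_{i=0}^{\ell}\sum_{j=0}^{m}T_{i,j}, $$ where $$ T_{i,j}=q^{i+(m-n)j+\binom{j+1}{2}}\,\frac{1}{c^i}\,\frac{1-q^{1-2\ell+2i}/a^2}{1-q^{1-2\ell}/a^2}\, \frac{(q^{-\ell},\,c/a,\,q^{1-2\ell}/a^2;q)_i}{(q,\,q^{2-2\ell}/(ac),\,q^{2-\ell}/a^2;q)_i} $$ $$ \times\frac{(q^{-m},\,q^{-n},\,-q^{-n},\,q^{2\ell-i-1}ac,\,q^{i}c/a;q)_j}{(q,\,q^{\ell}c,\,-q^{\ell}c,\,q^{m-2n},\,q^{j-2n-1};q)_j}\, \frac{(q^{2\ell-i+j}ac,\,q^{1+i+j}c/a;q^2)_{n-j}}{(q,\,q^{2\ell+2j}c^2;q^2)_{n-j}}. $$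
   Context: $q$ is a nonzero complex number. For complex $x$ and an integer $n\ge 0$, the $q$-shifted factorial is $(x;q)_0=1$, $(x;q)_n=\prod_{k=0}^{n-1}(1-xq^k)$, and $(x_1,\dots,x_r;q)_n=\prod_{s=1}^r (x_s;q)_n$ (likewise with base $q^2$ in place of $q$). The basic hypergeometric series is ${}_4\phi_3\left[\begin{matrix}a_0,a_1,a_2,a_3\\ b_1,b_2,b_3\end{matrix};q,z\right]=\sum_{k\ge0}\frac{(a_0,a_1,a_2,a_3;q)_k}{(q,b_1,b_2,b_3;q)_k}z^k$. Here one upper parameter is $q^{-n}$, so the series terminates and means the sum over $0\le k\le n$. Parameters are assumed to be such that no zero factor appears in a denominator of the displayed expressions. *)

(* Defs.v *)
From mathcomp Require Import all_boot all_order all_algebra.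
From mathcomp Require Import reals complex.

Set Implicit Arguments.
Unset Strict Implicit.
Unset Printing Implicit Defensive.

Import GRing.Theory.
Local Open Scope ring_scope.

(* (x; q)_n *)
Definition qpoch (F : fieldType) (q x : F) (n : nat) : F :=
  \prod_(k < n) (1 - x * q ^+ k).

(* (x_1, ..., x_r; q)_n *)
Definition qpochs (F : fieldType) (q : F) (xs : seq F) (n : nat) : F :=
  \prod_(x <- xs) qpoch q x n.

(* The terminating series 4phi3[a0, a1, a2, a3; b1, b2, b3; q, z], summed over
   0 <= k <= n; it is meant for the case where one upper parameter is q^(-n),
   so that all later numerators vanish. *)
Definition phi43 (F : fieldType) (n : nat) (a0 a1 a2 a3 b1 b2 b3 q z : F) : F :=
  \sum_(k < n.+1)
    qpochs q [:: a0; a1; a2; a3] k / qpochs q [:: q; b1; b2; b3] k * z ^+ k.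

(* The summand T_{i,j}; exponents that may be negative are computed in int. *)
Definition qterm (F : fieldType) (q a c : F) (l m n i j : nat) : F :=
  q ^ (i%:Z + (m%:Z - n%:Z) * j%:Z + 'C(j.+1, 2)%:Z)
  * (1 / c ^+ i)
  * ((1 - q ^ (1 - 2 * l%:Z + 2 * i%:Z) / a ^+ 2)
     / (1 - q ^ (1 - 2 * l%:Z) / a ^+ 2))
  * (qpochs q [:: q ^ (- l%:Z); c / a; q ^ (1 - 2 * l%:Z) / a ^+ 2] i
     / qpochs q [:: q; q ^ (2 - 2 * l%:Z) / (a * c);
                    q ^ (2 - l%:Z) / a ^+ 2] i)
  * (qpochs q [:: q ^ (- m%:Z); q ^ (- n%:Z); - q ^ (- n%:Z);
                  q ^ (2 * l%:Z - i%:Z - 1) * a * c; q ^+ i * c / a] j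
     / qpochs q [:: q; q ^+ l * c; - q ^+ l * c; q ^ (m%:Z - 2 * n%:Z);
                    q ^ (j%:Z - 2 * n%:Z - 1)] j)
  * (qpochs (q ^+ 2) [:: q ^ (2 * l%:Z - i%:Z + j%:Z) * a * c;
                         q ^+ (1 + i + j) * c / a] (n - j)
     / qpochs (q ^+ 2) [:: q; q ^+ (2 * l + 2 * j) * c ^+ 2] (n - j)).

(* Main.v *)
Require Import Defs.
From mathcomp Require Import all_boot all_order all_algebra.
From mathcomp Require Import reals complex.
From mathcomp Require Import ring zify.
Import GRing.Theory.
Local Open Scope ring_scope.

(** The ratio (a, q^(1-l)/a; q)_k / (c; q)_k is a combination of the ratios
    (aq^(l-i), q^(1-l+i)/a; q)_k / (q^l c; q)_k, 0 <= i <= l, with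
    very-well-poised coefficients: raising c to qc while replacing either a by qa
    or q^(1-l)/a by q^(2-l)/a is a two-term relation, and iterating it gives a
    Pascal-type recurrence for the coefficients. This avoids the 6phi5 sum, some
    denominators of which may vanish under the given hypotheses.

    What remains is the case l = 0, with alpha = aq^(l-i) and gamma = q^l c.
    Sears' transformation turns its 4phi3 into
    4phi3[q^(-n), -q^(m-n), gamma/alpha, alpha gamma/q;
    gamma, -gamma, q^(m-2n); q, q].
    Sears' transformation is obtained by comparing coefficients in a product of
    two 2phi1 series, each rewritten by Euler's transformation. A second
    two-term relation lowers m to 0, and the series with m = 0 is summed by
    Andrews' terminating q-analogue of Watson's theorem, proved by telescoping. *)

Ltac nz := repeat (apply/andP; split); rewrite ?mulf_neq0 ?expf_neq0 ?oppr_eq0 ?oner_neq0 //.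

Section QSeries.
Set Implicit Arguments.
Unset Strict Implicit.
Variable F : fieldType.
Implicit Types q x y N M : F.

(** * Splitting and reversing $q$-shifted factorials *)

Lemma qpoch0 q x : qpoch q x 0 = 1.
Proof. by rewrite /qpoch big_ord0. Qed.

Lemma qpochSr q x n : qpoch q x n.+1 = qpoch q x n * (1 - x * q ^+ n).
Proof. by rewrite /qpoch big_ord_recr. Qed.

Lemma qpochSl q x n : qpoch q x n.+1 = (1 - x) * qpoch q (x * q) n.
Proof.
rewrite /qpoch big_ord_recl expr0 mulr1; congr (_ * _).
by apply: eq_bigr => i _; rewrite exprS mulrA.
Qed.

Lemma qpochD q x m n : qpoch q x (m + n) = qpoch q x m * qpoch q (x * q ^+ m) n.
Proof.
elim: n => [|n IHn]; first by rewrite addn0 qpoch0 mulr1.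
by rewrite addnS !qpochSr IHn exprD !mulrA.
Qed.

Lemma qpoch_neq0P q x n :
  reflect (forall k, (k < n)%N -> 1 - x * q ^+ k != 0) (qpoch q x n != 0).
Proof.
apply: (iffP idP) => [/prodf_neq0 h k hk | h].
  exact: (h (Ordinal hk) isT).
by apply/prodf_neq0 => i _; apply: h.
Qed.

Lemma qpoch_neq0_le q x m n :
  (m <= n)%N -> qpoch q x n != 0 -> qpoch q x m != 0.
Proof.
move=> hmn /qpoch_neq0P h; apply/qpoch_neq0P => k hk.
exact: h (leq_trans hk hmn).
Qed.

Lemma qpoch_sqr q x n :
  qpoch q x n * qpoch q (- x) n = qpoch (q ^+ 2) (x ^+ 2) n.
Proof.
rewrite /qpoch -big_split; apply: eq_bigr => i _ /=.
by rewrite exprAC -exprMn mulNr opprK -subr_sqr expr1n.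
Qed.

Lemma qpochs_nil q n : qpochs q [::] n = 1.
Proof. by rewrite /qpochs big_nil. Qed.

Lemma qpochs_cons q x s n : qpochs q (x :: s) n = qpoch q x n * qpochs q s n.
Proof. by rewrite /qpochs big_cons. Qed.

Definition qpochsE := (qpochs_cons, qpochs_nil, mulr1).

(** In closed form $(-1)^k q^{nk-\binom{k+1}{2}}$. It does not depend on [x], so it cancels from
    every ratio with equally many reversed factorials above and below. *)
Definition qrev q n k : F := \prod_(i < k) - (q ^+ n / q ^+ i.+1).

(** The last [k] factors are read backwards: $1-xq^{n-1-i}=(1-q^{1-n+i}/x)\cdot
    x\cdot(-q^{n-1-i})$. *)
Lemma qpoch_rev q x n k : q != 0 -> x != 0 -> (k <= n)%N ->
  qpoch q x n = qpoch q x (n - k) * (qpoch q (q / q ^+ n / x) k * (x ^+ k * qrev q n k)).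
Proof.
move=> q0 x0; elim: k => [|k IHk] hk.
  by rewrite subn0 qpoch0 /qrev big_ord0 !mulr1.
rewrite (IHk (ltnW hk)) /qrev big_ord_recr /= -/(qrev q n k).
have -> : (n - k = (n - k.+1).+1)%N by lia.
rewrite !qpochSr.
have -> : q ^+ n = q ^+ (n - k.+1) * q ^+ k * q.
  by rewrite -exprD -exprSr; congr (_ ^+ _); lia.
rewrite !exprS.
field.
by rewrite q0 x0 !expf_neq0.
Qed.

(** * Euler's and Sears' transformations *)

(** The coefficient of $z^n$ in ${}_2\phi_1(x,y;d;q,z)$. *)
Definition qratio q x y d n : F := qpoch q x n * qpoch q y n / (qpoch q q n * qpoch q d n).

Lemma telescope_sum_ord (V : zmodType) (f : nat -> V) n :
  \sum_(i < n) (f i.+1 - f i) = f n - f 0.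
Proof. by rewrite -(big_mkord xpredT (fun i => f i.+1 - f i)) telescope_sumr. Qed.

(* The coefficient form of Euler's transformation 2phi1(yw, xw; xyw; z) =
   1phi0(w; z) * 2phi1(x, y; xyw; wz). Both sides satisfy the same first order
   recurrence in k; [g] is the telescoping certificate. *)
Lemma qEuler q x y w k :
  qpoch q q k != 0 -> qpoch q (x * y * w) k != 0 ->
  \sum_(r < k.+1) qratio q x y (x * y * w) r * w ^+ r
     * (qpoch q w (k - r) / qpoch q q (k - r))
  = qratio q (y * w) (x * w) (x * y * w) k.
Proof.
set d := x * y * w.
elim: k => [|k IHk] hq hd.
  by rewrite big_ord_recl big_ord0 /qratio subnn !qpoch0 !mul1r !divr1 addr0 mulr1.
have hq' := qpoch_neq0_le (leqnSn k) hq.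
have hd' := qpoch_neq0_le (leqnSn k) hd.
have/qpoch_neq0P/(_ k (leqnn _)) hqk := hq.
have/qpoch_neq0P/(_ k (leqnn _)) hdk := hd.
have {}IHk := IHk hq' hd'.
pose u k r := qratio q x y d r * w ^+ r * (qpoch q w (k - r) / qpoch q q (k - r)).
(* At [r = 0] the truncated predecessor [r.-1] is harmless, since the factor [1 - q ^+ r] vanishes
   there. This is why [step] treats [r = 0] apart. *)
pose g r := - (q ^+ (k.+1 - r) * (1 - q ^+ r) * (1 - x * y * w * q ^+ r.-1)) * u k.+1 r.
have hqn r : (r <= k)%N -> (1 - q * q ^+ r != 0) && (qpoch q q r != 0).
  move=> hr; rewrite (qpoch_neq0_le _ hq) ?(leq_trans hr) // andbT.
  by move/qpoch_neq0P: hq => /(_ r hr).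
have hdn r : (r <= k)%N -> (1 - d * q ^+ r != 0) && (qpoch q d r != 0).
  move=> hr; rewrite (qpoch_neq0_le _ hd) ?(leq_trans hr) // andbT.
  by move/qpoch_neq0P: hd => /(_ r hr).
have step r : (r < k.+1)%N -> (1 - q * q ^+ k) * (1 - d * q ^+ k) * u k.+1 r
    - (1 - y * w * q ^+ k) * (1 - x * w * q ^+ k) * u k r = g r.+1 - g r.
  rewrite ltnS => hr; rewrite /g /u /= subSS.
  have [s ks] : exists s, k = (r + s)%N by exists (k - r)%N; lia.
  have hs : (s <= k)%N by lia.
  have -> : (k - r = s)%N by lia.
  have -> : (k.+1 - r = s.+1)%N by lia.
  have/andP[q1 q2] := hqn _ hr; have/andP[d1 d2] := hdn _ hr.
  have/andP[q3 q4] := hqn _ hs.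
  rewrite /qratio ks; case: r ks hr q1 q2 d1 d2 => [|r] ks hr q1 q2 d1 d2.
    rewrite !qpochSr !qpoch0 ?exprS !expr0 !add0n !mulr1 /d in q1 q2 d1 d2 *.
    field.
    by nz; rewrite ?oner_neq0.
  rewrite !qpochSr in q2 d2 *.
  move: q2 d2; rewrite !mulf_eq0 !negb_or => /andP[q5 q6] /andP[d5 d6].
  rewrite ?exprS ?exprD ?exprS /d /= in q1 q6 d1 d6 *.
  field.
  by nz.
apply: (mulfI (mulf_neq0 hqk hdk)).
have tel : \sum_(r < k.+1) ((1 - q * q ^+ k) * (1 - d * q ^+ k) * u k.+1 r
    - (1 - y * w * q ^+ k) * (1 - x * w * q ^+ k) * u k r) = g k.+1.
  under eq_bigr => r _ do rewrite step //.
  by rewrite telescope_sum_ord /g expr0 subrr mulr0 mul0r oppr0 mul0r subr0.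
rewrite sumrB -!mulr_sumr IHk in tel.
rewrite (_ : \sum_(r < _) _ = \sum_(r < k.+2) u k.+1 r) //.
rewrite big_ord_recr /= mulrDr.
move/eqP: tel; rewrite subr_eq => /eqP ->.
(* The boundary value [g k.+1] cancels the top term [r = k.+1] of the sum; what remains is the
   recurrence of the right-hand side. *)
rewrite /g subnn expr0 mul1r mulNr.
rewrite addrAC -exprS /= addNr add0r /qratio !qpochSr.
rewrite exprS.
field.
by nz.
Qed.

(** Both sides are the coefficient of $z^n$ in
    ${}_2\phi_1(x,y;xyw;wz)\,{}_1\phi_0(w;z)\,{}_2\phi_1(e,f;efw;wz)$: Euler's transformation
    absorbs the middle factor into the left series or into the right one. *)
Lemma qratio_convolution q x y e f w n :
  qpoch q q n != 0 -> qpoch q (x * y * w) n != 0 -> qpoch q (e * f * w) n != 0 ->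
  \sum_(k < n.+1) qratio q (y * w) (x * w) (x * y * w) k
     * (qratio q e f (e * f * w) (n - k) * w ^+ (n - k))
  = \sum_(k < n.+1) qratio q x y (x * y * w) k * w ^+ k
     * qratio q (f * w) (e * w) (e * f * w) (n - k).
Proof.
move=> hq hd hd'.
(* Truncating the three series at degree [n] preserves all coefficients of their products up to
   degree [n]. *)
pose h := \poly_(i < n.+1) (qpoch q w i / qpoch q q i).
pose S a b := \poly_(i < n.+1) (qratio q a b (a * b * w) i * w ^+ i).
have SE a b k : (k <= n)%N -> (S a b)`_k = qratio q a b (a * b * w) k * w ^+ k.
  by move=> hk; rewrite coef_poly ltnS hk.
have ShE a b k : qpoch q (a * b * w) n != 0 -> (k <= n)%N ->
    (S a b * h)`_k = qratio q (b * w) (a * w) (a * b * w) k.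
  move=> hab hk; rewrite coefM -qEuler; first last.
  - exact: qpoch_neq0_le hab.
  - exact: qpoch_neq0_le hq.
  apply: eq_bigr => i _; have hi : (i <= k)%N by rewrite -ltnS.
  rewrite SE ?(leq_trans hi) // coef_poly ltnS (leq_trans _ hk) //.
  exact: leq_subr.
transitivity ((S x y * h * S e f)`_n).
  rewrite coefM; apply: eq_bigr => i _.
  by rewrite ShE ?SE ?leq_subr // -ltnS.
rewrite -mulrA [h * _]mulrC coefM; apply: eq_bigr => i _.
by rewrite SE ?ShE ?leq_subr // -ltnS.
Qed.

(** Makes a convolution in [k] and [n - k] into a single series in [k]: the four copies of [qrev]
    cancel, and the powers from [qpoch_rev] combine into the last factor. *)
Lemma qratio_rev q e f d n k : q != 0 -> e != 0 -> f != 0 -> d != 0 ->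
  qpoch q q n != 0 -> qpoch q d n != 0 -> qpoch q e n != 0 -> qpoch q f n != 0 ->
  (k <= n)%N ->
  qratio q e f d (n - k) = qratio q e f d n
   * (qpoch q (q / q ^+ n / q) k * qpoch q (q / q ^+ n / d) k
      / (qpoch q (q / q ^+ n / e) k * qpoch q (q / q ^+ n / f) k))
   * (q * d / (e * f)) ^+ k.
Proof.
move=> q0 e0 f0 d0 hq hd he hf hk; rewrite /qratio.
rewrite (qpoch_rev q0 q0 hk) in hq *; rewrite (qpoch_rev q0 d0 hk) in hd *.
rewrite (qpoch_rev q0 e0 hk) in he *; rewrite (qpoch_rev q0 f0 hk) in hf *.
move: hq hd he hf; rewrite !mulf_eq0 !negb_or.
case/and4P=> ? ? _ ? /and4P[? ? _ _] /and4P[? ? _ _] /and4P[? ? _ _].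
rewrite !exprMn !exprVn !exprMn.
field.
by nz.
Qed.

(* Sears' 4phi3 transformation. The upper parameters [Q q] and [Q (e * f * w)]
   are q^(-n) and q^(1-n)/(efw). *)
Lemma sears q x y w e f n : q != 0 -> e != 0 -> f != 0 -> w != 0 ->
  qpoch q q n != 0 -> qpoch q (x * y * w) n != 0 -> qpoch q (e * f * w) n != 0 ->
  qpoch q e n != 0 -> qpoch q f n != 0 ->
  qpoch q (e * w) n != 0 -> qpoch q (f * w) n != 0 ->
  let Q z := q / q ^+ n / z in
  w ^+ n * (qpoch q e n * qpoch q f n)
   * (\sum_(k < n.+1) qpochs q [:: y * w; x * w; Q q; Q (e * f * w)] k
      / qpochs q [:: q; x * y * w; Q e; Q f] k * q ^+ k)
  = qpoch q (f * w) n * qpoch q (e * w) n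
   * (\sum_(k < n.+1) qpochs q [:: x; y; Q q; Q (e * f * w)] k
      / qpochs q [:: q; x * y * w; Q (f * w); Q (e * w)] k * q ^+ k).
Proof.
move=> q0 e0 f0 w0 hq hd hd' he hf hew hfw Q.
have := @qratio_convolution q x y e f w n hq hd hd'.
move/(congr1 (fun z => qpoch q q n * qpoch q (e * f * w) n * z)).
rewrite !mulr_sumr => E.
transitivity (\sum_(k < n.+1) qpoch q q n * qpoch q (e * f * w) n * (qratio q (y * w) (x *
    w) (x * y * w) k
     * (qratio q e f (e * f * w) (n - k) * w ^+ (n - k)))); first last.
  rewrite E; apply: eq_bigr => k _; have hk : (k <= n)%N by rewrite -ltnS.
  rewrite qratio_rev ?mulf_neq0 // !qpochsE -/(Q (f * w)) -/(Q (e * w)) -/(Q q) -/(Q (e * f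
      * w)).
  (* Reversal leaves the power $(q/w)^k$ here, and $(qw)^k$ in the other half; the explicit powers
     of [w] turn both into $q^k$, the argument of Sears' series. *)
  have -> : q ^+ k = w ^+ k * (q * (e * f * w) / (f * w * (e * w))) ^+ k.
    by rewrite -exprMn; congr (_ ^+ _); field; nz.
  rewrite /qratio !invfM.
  (* The quotients [divff] are inserted so that [ring], treating inverses as atoms, matches the two
     sides. *)
  rewrite -[RHS]mul1r -(divff hq) -[RHS]mul1r -(divff hd').
  ring.
apply: eq_bigr => k _; have hk : (k <= n)%N by rewrite -ltnS.
rewrite qratio_rev ?mulf_neq0 // !qpochsE -/(Q e) -/(Q f) -/(Q q) -/(Q (e * f * w)).
have -> : w ^+ n * (qpoch q e n * qpoch q f n) = w ^+ (n - k) * (qpoch q e n * qpoch q f n)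
    * w ^+ k.
  by rewrite -{1}(subnK hk) exprD mulrAC.
have -> : (q * (e * f * w) / (e * f)) ^+ k = w ^+ k * q ^+ k.
  by rewrite -exprMn; congr (_ ^+ _); field; nz.
rewrite /qratio !invfM.
rewrite -[LHS]mul1r -(divff hq) -[LHS]mul1r -(divff hd').
ring.
Qed.

(** * Nonvanishing of factorials when low powers of $q$ differ from 1 *)

Lemma exprN_sqr q n : (q ^- n) ^+ 2 = q ^- (2 * n).
Proof. by rewrite exprVn -exprM mulnC. Qed.

Lemma exprN_mul q m n : q != 0 -> (m <= n)%N -> q ^- n * q ^+ m = q ^- (n - m).
Proof.
move=> q0 hmn; rewrite -{1}(subnK hmn) exprD.
by field; rewrite !expf_neq0.
Qed.

Lemma qpoch_inv_neq0 q n p k : q != 0 ->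
  (forall e, (0 < e <= p)%N -> q ^+ e != 1) -> (n <= p)%N -> (k <= n)%N ->
  qpoch q (q ^- n) k != 0.
Proof.
move=> q0 hq hn hk; apply/qpoch_neq0P => i hi.
rewrite exprN_mul ?(leq_trans (ltnW hi)) //.
by rewrite subr_eq0 eq_sym invr_eq1 hq //; lia.
Qed.

Lemma qpoch_self_neq0 q p k :
  (forall e, (0 < e <= p)%N -> q ^+ e != 1) -> (k <= p)%N -> qpoch q q k != 0.
Proof.
move=> hq hk; apply/qpoch_neq0P => i hi.
by rewrite subr_eq0 eq_sym -exprS hq // (leq_trans hi).
Qed.

Lemma expr_sqr q k : (q ^+ 2) ^+ k = q ^+ k * q ^+ k.
Proof. by rewrite exprAC expr2. Qed.

(** * Andrews' terminating $q$-analogue of Watson's theorem *)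

(** For $Y=q^{-2n}$, the summand of
    ${}_4\phi_3[q^{-n},-q^{-n},x,y;\sqrt{qxy},-\sqrt{qxy},q^{-2n};q,q]$. Pairing opposite parameters
    into base $q^2$ avoids the square roots. *)
Definition watson_term q x y Y k : F :=
  qpoch (q ^+ 2) Y k * qpoch q x k * qpoch q y k
  / (qpoch q q k * qpoch q Y k * qpoch (q ^+ 2) (q * x * y) k) * q ^+ k.

(* Wilf-Zeilberger certificate for the first order recurrence in n, where
   Y = q^(-2n). *)
Definition watson_cert q x y Y k : F :=
  q * Y / q ^+ k * (1 - q ^+ k) * (1 - x * y * (q ^+ k * q ^+ k) / q) / (1 - Y * q ^+ k)
  * watson_term q x y Y k.

(** The coefficients come from the closed form: with $Y=q^{-2(n+1)}$, passing from $n$ to $n+1$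
    multiplies it by $(qY-x)(qY-y)/((qY-1)(qY-xy))$. *)
Lemma watson_step q x y Y k : q != 0 -> qpoch q q k.+1 != 0 ->
  qpoch q Y k.+2 != 0 -> qpoch (q ^+ 2) (q * x * y) k.+1 != 0 ->
  (q * Y - 1) * (q * Y - x * y) * watson_term q x y Y k
  - (q * Y - x) * (q * Y - y) * watson_term q x y (Y * q ^+ 2) k
  = (q * Y - 1) * (watson_cert q x y Y k.+1 - watson_cert q x y Y k).
Proof.
move=> q0 hq hY hd.
have hY0 : 1 - Y != 0 by move/qpoch_neq0P: hY => /(_ 0%N isT); rewrite mulr1.
have hY1 : 1 - Y * q != 0 by move/qpoch_neq0P: hY => /(_ 1%N isT).
have E1 : qpoch (q ^+ 2) (Y * q ^+ 2) k = qpoch (q ^+ 2) Y k * (1 - Y * (q ^+ k * q ^+ k))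
    / (1 - Y).
  by rewrite -expr_sqr -qpochSr qpochSl mulrAC divff ?mul1r.
have E2 : qpoch q (Y * q ^+ 2) k = qpoch q Y k * (1 - Y * q ^+ k) * (1 - Y * q * q ^+ k) /
    ((1 - Y) * (1 - Y * q)).
  have -> : 1 - Y * q * q ^+ k = 1 - Y * q ^+ k.+1 by rewrite exprS mulrA.
  rewrite -!qpochSr !qpochSl expr2 mulrA.
  by field; nz.
rewrite /watson_cert /watson_term E1 E2.
move: hq hY hd; rewrite !qpochSr !expr_sqr !exprS !mulf_eq0 !negb_or.
case/andP=> ? ? /andP[/andP[? ?] ?] /andP[? ?].
field.
by nz.
Qed.

Lemma andrews_watson q x y n : q != 0 ->
  (forall e, (0 < e <= 2 * n)%N -> q ^+ e != 1) ->
  qpoch (q ^+ 2) (q * x * y) n != 0 ->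
  \sum_(k < n.+1) watson_term q x y (q ^- (2 * n)) k
  = qpoch (q ^+ 2) (q * x) n * qpoch (q ^+ 2) (q * y) n
    / (qpoch (q ^+ 2) q n * qpoch (q ^+ 2) (q * x * y) n).
Proof.
move=> q0; elim: n => [|n IHn] hq hd.
  by rewrite big_ord_recl big_ord0 /watson_term !qpoch0 expr0 !mulr1 divr1 addr0.
set Y := q ^- (2 * n.+1).
have qn0 := expf_neq0 n q0.
have YE : Y = (q * q * (q ^+ n * q ^+ n))^-1.
  by rewrite /Y -expr2 -exprD -exprD; congr (_ ^-1); congr (_ ^+ _); lia.
have Y' : Y * q ^+ 2 = q ^- (2 * n).
  by rewrite YE mulnC exprM expr2; field; nz.
have {}IHn : \sum_(k < n.+1) watson_term q x y (Y * q ^+ 2) k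
  = qpoch (q ^+ 2) (q * x) n * qpoch (q ^+ 2) (q * y) n
    / (qpoch (q ^+ 2) q n * qpoch (q ^+ 2) (q * x * y) n).
  rewrite Y' IHn //; last exact: qpoch_neq0_le hd.
  by move=> e he; apply: hq; lia.
have hqq : forall i, (i <= n.+1)%N -> qpoch q q i != 0.
  by move=> i hi; apply: (qpoch_self_neq0 hq); lia.
have hYi : forall i, (i <= 2 * n.+1)%N -> qpoch q Y i != 0.
  by move=> i hi; apply: (qpoch_inv_neq0 q0 hq) => //; lia.
(* The relation is summed only up to [k = n], where the series for [n] ends. At the lower end the
   certificate vanishes through its factor [1 - q ^+ 0]. *)
have tel : \sum_(k < n.+1) ((q * Y - 1) * (q * Y - x * y) * watson_term q x y Y k
  - (q * Y - x) * (q * Y - y) * watson_term q x y (Y * q ^+ 2) k)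
  = (q * Y - 1) * watson_cert q x y Y n.+1.
  rewrite (eq_bigr (fun k : 'I_n.+1 => (q * Y - 1) * (watson_cert q x y Y k.+1 -
      watson_cert q x y Y k))).
    rewrite -mulr_sumr (telescope_sum_ord (watson_cert q x y Y)).
    by rewrite /watson_cert expr0 subrr mulr0 !mul0r subr0.
  move=> k _; have hk := ltn_ord k; apply: watson_step => //.
  - exact: hqq.
  - by apply: hYi; lia.
  - exact: qpoch_neq0_le hd.
rewrite sumrB -!mulr_sumr {}IHn in tel.
move/eqP: tel; rewrite subr_eq => /eqP tel.
have hqY : q * Y - 1 != 0.
  have -> : q * Y = (q ^+ (n + n).+1)^-1.
    by rewrite YE exprS exprD; field; nz.
  by rewrite subr_eq0 invr_eq1 hq //; lia.
have hdn : 1 - q * x * y * (q ^+ n * q ^+ n) != 0.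
  by move/qpoch_neq0P: hd => /(_ n (leqnn _)); rewrite expr_sqr.
have hqY' : q * Y - x * y != 0.
  have -> : q * Y - x * y = (1 - q * x * y * (q ^+ n * q ^+ n)) / (q * (q ^+ n * q ^+ n)).
    by rewrite YE; field; nz.
  by rewrite !mulf_neq0 ?invr_eq0 ?mulf_neq0.
apply: (mulfI (mulf_neq0 hqY hqY')).
rewrite big_ord_recr /= mulrDr tel.
(* The certificate at [n.+1] is minus the top term of the longer series, so the two cancel. *)
have -> : (q * Y - 1) * watson_cert q x y Y n.+1 = - ((q * Y - 1) * (q * Y - x * y) *
    watson_term q x y Y n.+1).
  rewrite /watson_cert YE exprS; field.
  by rewrite q0 qn0 subr_eq0 -exprS hq //; lia.
rewrite addrAC addNr add0r.
have hqs : qpoch (q ^+ 2) q n.+1 != 0.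
  apply/qpoch_neq0P => i hi.
  by rewrite subr_eq0 eq_sym -exprM -exprS hq //; lia.
move: hqs hd; rewrite !qpochSr !expr_sqr !mulf_eq0 !negb_or => /andP[? ?] /andP[? ?].
rewrite YE; field.
by nz.
Qed.

(** * Lowering $m$ to 0 by a two-term relation *)

(* In [sears_term], [shift_coef] and [inner_term], N and M stand for q^(-n) and
   q^(-m); lowering n or m by one multiplies them by q. *)
Definition sears_term q x y N M k : F :=
  qpoch q N k * qpoch q (- (N / M)) k * qpoch q x k * qpoch q y k
  / (qpoch q q k * qpoch (q ^+ 2) (q * x * y) k * qpoch q (N ^+ 2 / M) k) * q ^+ k.

Definition shift_coef q x y N M : F :=
  - (N / (M * q)) * (1 + N) / ((1 - N ^+ 2 / (M * q)) * (1 - N ^+ 2 / M))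
  * (q * (1 - N) * (1 - x) * (1 - y) / (1 - q * x * y)).

(** The closed form of [andrews_watson] at [q ^+ j * x], [q ^+ j * y] and [n - j]. *)
Definition qwatson_tail q x y n j : F :=
  qpoch (q ^+ 2) (q ^+ j.+1 * x) (n - j) * qpoch (q ^+ 2) (q ^+ j.+1 * y) (n - j)
  / (qpoch (q ^+ 2) q (n - j) * qpoch (q ^+ 2) (q ^+ (2 * j) * (q * x * y)) (n - j)).

Definition inner_term q x y N M n j : F :=
  (N / M) ^+ j * q ^+ 'C(j.+1, 2)
  * (qpoch q M j * qpoch q N j * qpoch q (- N) j * qpoch q x j * qpoch q y j
     / (qpoch q q j * qpoch (q ^+ 2) (q * x * y) j * qpoch q (N ^+ 2 / M) j
        * qpoch q (N ^+ 2 * q ^+ j / q) j))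
  * qwatson_tail q x y n j.

Lemma subr1_div_neq0 (x y : F) : y != 0 -> 1 - x / y != 0 -> y - x != 0.
Proof.
move=> y0; have -> : 1 - x / y = (y - x) / y by field.
by rewrite mulf_eq0 negb_or => /andP[].
Qed.

Lemma qpoch_shift q x n : 1 - x != 0 ->
  qpoch q (x * q) n = qpoch q x n * (1 - x * q ^+ n) / (1 - x).
Proof. by move=> hx; rewrite -qpochSr qpochSl mulrAC divff ?mul1r. Qed.

(** Only $u=-N/M$ and $v=N^2/M$ involve $M$. After removing the common factors, the difference is
    governed by $(1-uq^k)(1-v/q)-(1-u/q)(1-vq^k)=(u-v)(1-q^{k+1})/q$; the factor $1-q^{k+1}$ lowers
    the index of $(q;q)_{k+1}$ and leaves a shifted summand. *)
Lemma sears_term_pascal q x y N M k : q != 0 -> M != 0 ->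
  qpoch q q k.+1 != 0 -> qpoch (q ^+ 2) (q * x * y) k.+1 != 0 ->
  qpoch q (N ^+ 2 / M) k.+1 != 0 -> qpoch q (N ^+ 2 / (M * q)) k.+1 != 0 ->
  sears_term q x y N M k.+1
  = sears_term q x y N (M * q) k.+1
    + shift_coef q x y N M * sears_term q (q * x) (q * y) (N * q) (M * q) k.
Proof.
move=> q0 M0 hq hd h1 h2.
have h10 : 1 - N ^+ 2 / M != 0 by move/qpoch_neq0P: h1 => /(_ 0%N isT); rewrite mulr1.
have h20 : 1 - N ^+ 2 / (M * q) != 0 by move/qpoch_neq0P: h2 => /(_ 0%N isT); rewrite mulr1.
rewrite /sears_term /shift_coef.
have -> : N * q / (M * q) = N / M by field; nz.
have -> : (N * q) ^+ 2 / (M * q) = N ^+ 2 / M * q by field; nz.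
have -> : q * (q * x) * (q * y) = q * x * y * q ^+ 2 by ring.
have E : - (N / M) = - (N / (M * q)) * q by field; nz.
have h2E : N ^+ 2 / M = N ^+ 2 / (M * q) * q by field; nz.
rewrite (qpoch_shift q _ h10).
rewrite [qpoch q (- (N / (M * q))) _]qpochSl -E.
rewrite [qpoch q (N ^+ 2 / (M * q)) _]qpochSl -h2E.
rewrite [qpoch q N _]qpochSl [qpoch q x _]qpochSl [qpoch q y _]qpochSl.
rewrite [qpoch _ (q * x * y) _]qpochSl.
rewrite [x * q]mulrC [y * q]mulrC.
rewrite [qpoch q q k.+1]qpochSr [qpoch q (- (N / M)) k.+1]qpochSr.
rewrite [qpoch q (N ^+ 2 / M) k.+1]qpochSr.
move: hq hd h1 h2; rewrite [qpoch q q _]qpochSr [qpoch q (N ^+ 2 / M) k.+1]qpochSr [qpoch _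
    (q * x * y) _]qpochSl ![q ^+ k.+1]exprS.
rewrite !mulf_eq0 !negb_or [_ / M * q ^+ k]mulrAC.
case/andP=> ? ? /andP[? ?] /andP[? /(subr1_div_neq0 M0) ?] _.
have ? := subr1_div_neq0 M0 h10; have ? := subr1_div_neq0 (mulf_neq0 M0 q0) h20.
field.
by nz; rewrite -expr2.
Qed.

(** The expansion obeys the relation of [sears_term_pascal] with the same coefficient, which lets
    both sums be compared by induction on $m$. *)
Lemma inner_term_pascal q x y N M n j : q != 0 -> M != 0 ->
  qpoch q q j.+1 != 0 -> qpoch (q ^+ 2) (q * x * y) j.+1 != 0 ->
  qpoch q (N ^+ 2 / M) j.+1 != 0 -> qpoch q (N ^+ 2 / (M * q)) j.+1 != 0 ->
  qpoch q (N ^+ 2 * q ^+ j) j.+1 != 0 ->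
  inner_term q x y N M n.+1 j.+1
  = inner_term q x y N (M * q) n.+1 j.+1
    + shift_coef q x y N M * inner_term q (q * x) (q * y) (N * q) (M * q) n j.
Proof.
move=> q0 M0 hq hd h1 h2 h3.
have h10 : 1 - N ^+ 2 / M != 0 by move/qpoch_neq0P: h1 => /(_ 0%N isT); rewrite mulr1.
have h20 : 1 - N ^+ 2 / (M * q) != 0 by move/qpoch_neq0P: h2 => /(_ 0%N isT); rewrite mulr1.
rewrite /inner_term /shift_coef.
have -> : N * q / (M * q) = N / M by field; nz.
have -> : (N * q) ^+ 2 / (M * q) = N ^+ 2 / M * q by field; nz.
(* The tail sees only $q^jx$, $q^jy$ and $n-j$, so it is a common factor of all three terms. *)
have -> : qwatson_tail q (q * x) (q * y) n j = qwatson_tail q x y n.+1 j.+1.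
  have E : q ^+ (2 * j.+1) = q ^+ (2 * j) * q ^+ 2 by rewrite mulnS addnC exprD.
  rewrite /qwatson_tail subSS E ![q ^+ j.+2]exprSr.
  by rewrite !mulrA; congr (_ / (_ * qpoch _ _ _)); ring.
move: (qwatson_tail _ _ _ _ _) => tail.
have -> : q * (q * x) * (q * y) = q * x * y * q ^+ 2 by ring.
have -> : (N * q) ^+ 2 * q ^+ j / q = N ^+ 2 * q ^+ j * q by field; nz.
have -> : N ^+ 2 * q ^+ j.+1 / q = N ^+ 2 * q ^+ j by rewrite [q ^+ j.+1]exprS; field; nz.
have -> : - (N * q) = - N * q by ring.
have h2E : N ^+ 2 / M = N ^+ 2 / (M * q) * q by field; nz.
rewrite (qpoch_shift q _ h10).
rewrite [qpoch q (N ^+ 2 / (M * q)) _]qpochSl -h2E.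
rewrite [qpoch q N _]qpochSl [qpoch q (- N) _]qpochSl [qpoch q x _]qpochSl [qpoch q y _]qpochSl.
rewrite [qpoch _ (q * x * y) _]qpochSl [qpoch q M _]qpochSl.
rewrite [qpoch _ (N ^+ 2 * q ^+ j) _]qpochSl.
rewrite [x * q]mulrC [y * q]mulrC.
rewrite [qpoch q q j.+1]qpochSr [qpoch q (M * q) j.+1]qpochSr.
rewrite [qpoch q (N ^+ 2 / M) j.+1]qpochSr.
have -> : 'C(j.+2, 2) = ('C(j.+1, 2) + j.+1)%N by rewrite binS bin1.
rewrite exprD [(N / M) ^+ _]exprS [(N / (M * q)) ^+ _]exprS.
have -> : (N / (M * q)) ^+ j = (N / M) ^+ j / q ^+ j by rewrite -expr_div_n; congr (_ ^+
    _); field; nz.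
move: hq hd h1 h2 h3; rewrite [qpoch q q _]qpochSr [qpoch q (N ^+ 2 / M) j.+1]qpochSr
    [qpoch _ (q * x * y) _]qpochSl.
rewrite [qpoch q (N ^+ 2 * q ^+ j) j.+1]qpochSl ![q ^+ j.+1]exprS !mulf_eq0 !negb_or [_ / M
    * q ^+ j]mulrAC.
case/andP=> ? ? /andP[? ?] /andP[? /(subr1_div_neq0 M0) ?] _ /andP[? ?].
have ? := subr1_div_neq0 M0 h10; have ? := subr1_div_neq0 (mulf_neq0 M0 q0) h20.
have qj0 := expf_neq0 j q0.
move: ((N / M) ^+ j) (q ^+ 'C(_, _)) => Z Z'.
field.
by nz.
Qed.

(** Induction on [m] with [n], [x] and [y] general, because the second term of the two-term relation
    lowers [n] and multiplies [x] and [y] by [q]. *)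
Lemma sears_sum_expand q x y n m : q != 0 ->
  (forall e, (0 < e <= 2 * n)%N -> q ^+ e != 1) ->
  qpoch (q ^+ 2) (q * x * y) n != 0 -> (m <= n)%N ->
  \sum_(k < n.+1) sears_term q x y (q ^- n) (q ^- m) k
  = \sum_(j < m.+1) inner_term q x y (q ^- n) (q ^- m) n j.
Proof.
move=> q0; elim: m n x y => [|m IHm] n x y hq hd hmn.
  (* For [m = 0] the upper parameters $q^{-n}$ and $-q^{-n}$ are opposite, which is the shape of
     Watson's series. *)
  rewrite [RHS]big_ord_recl big_ord0 addr0.
  transitivity (\sum_(k < n.+1) watson_term q x y (q ^- (2 * n)) k).
    apply: eq_bigr => k _; rewrite /sears_term /watson_term expr0 invr1 !divr1.
    by rewrite qpoch_sqr -exprN_sqr; congr (_ / _ * _); ring.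
  rewrite andrews_watson // /inner_term /qwatson_tail !qpoch0 !expr0 subn0.
  by rewrite !(mul1r, invr1) expr1.
case: n hmn hq hd => [//|n] hmn hq hd.
have qn0 := expf_neq0 n q0; have qm0 := expf_neq0 m q0.
have Nq : q ^- n.+1 * q = q ^- n by rewrite exprS; field; nz.
have Mq : q ^- m.+1 * q = q ^- m by rewrite exprS; field; nz.
have E1 : (q ^- n.+1) ^+ 2 / q ^- m.+1 = q ^- (2 * n.+1 - m.+1).
  by rewrite exprN_sqr invrK exprN_mul //; lia.
have E2 : (q ^- n.+1) ^+ 2 / (q ^- m.+1 * q) = q ^- (2 * n.+1 - m).
  by rewrite Mq exprN_sqr invrK exprN_mul //; lia.
have hqq k : (k <= 2 * n.+1)%N -> qpoch q q k != 0 by apply: qpoch_self_neq0.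
have hd' : qpoch (q ^+ 2) (q * (q * x) * (q * y)) n != 0.
  move: hd; rewrite qpochSl mulf_eq0 negb_or => /andP[_].
  by have -> : q * (q * x) * (q * y) = q * x * y * q ^+ 2 by ring.
have M0 : q ^- m.+1 != 0 by rewrite invr_eq0 expf_neq0.
have IH1 : \sum_(k < n.+2) sears_term q x y (q ^- n.+1) (q ^- m.+1 * q) k
    = \sum_(j < m.+1) inner_term q x y (q ^- n.+1) (q ^- m.+1 * q) n.+1 j.
  by rewrite Mq IHm // ltnW.
have IH2 : \sum_(k < n.+1) sears_term q (q * x) (q * y) (q ^- n.+1 * q) (q ^- m.+1 * q) k
    = \sum_(j < m.+1) inner_term q (q * x) (q * y) (q ^- n.+1 * q) (q ^- m.+1 * q) n j.
  by rewrite Mq Nq IHm // => e he; apply: hq; lia.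
transitivity (\sum_(k < n.+2) sears_term q x y (q ^- n.+1) (q ^- m.+1 * q) k
   + shift_coef q x y (q ^- n.+1) (q ^- m.+1)
     * \sum_(k < n.+1) sears_term q (q * x) (q * y) (q ^- n.+1 * q) (q ^- m.+1 * q) k).
  (* The terms of index 0 are free of [m], so the relation is applied from index 1 on. *)
  rewrite !(big_ord_recl n.+1) mulr_sumr -addrA -big_split /=.
  congr (_ + _); first by rewrite /sears_term !qpoch0.
  apply: eq_bigr => k _; have hk := ltn_ord k.
  rewrite sears_term_pascal //.
  - by apply: hqq; lia.
  - exact: qpoch_neq0_le hd.
  - by rewrite E1 (qpoch_inv_neq0 q0 hq) //; lia.
  - by rewrite E2 (qpoch_inv_neq0 q0 hq) //; lia.
rewrite IH1 IH2.
(* Since $(q^{-m};q)_{m+1}=0$, the shorter sum may be extended by one term to align the ranges. *)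
have last0 : inner_term q x y (q ^- n.+1) (q ^- m.+1 * q) n.+1 m.+1 = 0.
  by rewrite /inner_term Mq qpochSr mulVf // subrr !(mulr0, mul0r).
have -> : \sum_(j < m.+1) inner_term q x y (q ^- n.+1) (q ^- m.+1 * q) n.+1 j
    = \sum_(j < m.+2) inner_term q x y (q ^- n.+1) (q ^- m.+1 * q) n.+1 j.
  by rewrite [RHS]big_ord_recr /= last0 addr0.
rewrite !(big_ord_recl m.+1) mulr_sumr -addrA -big_split /=.
congr (_ + _); first by rewrite /inner_term !qpoch0.
apply: eq_bigr => j _; have hj := ltn_ord j.
rewrite /bump leq0n add1n [RHS]inner_term_pascal //.
- by apply: hqq; lia.
- by apply: qpoch_neq0_le hd; lia.
- by rewrite E1 (qpoch_inv_neq0 q0 hq) //; lia.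
- by rewrite E2 (qpoch_inv_neq0 q0 hq) //; lia.
- have -> : (q ^- n.+1) ^+ 2 * q ^+ j = q ^- (2 * n.+1 - j).
    by rewrite exprN_sqr exprN_mul //; lia.
  by rewrite (qpoch_inv_neq0 q0 hq) //; lia.
Qed.

(** * The very-well-poised expansion over $i$ *)

(* q^(1-2l)/a^2, the base parameter of the very-well-poised sum over i. *)
Definition outer_base q l (a : F) : F := q / (q ^+ l * q ^+ l * a ^+ 2).

(* The weight of the i-th term divided by [qpoch q a l]; without that factor the
   Pascal recurrence does not need 1 - a != 0. *)
Definition outer_coef q l i (a c : F) : F :=
  qpoch q (q ^+ l / q * a * c) l / (qpoch q c l * qpoch q (q ^+ l / q * a ^+ 2) l)
  * (q / c) ^+ i
  * ((1 - outer_base q l a * (q ^+ i * q ^+ i)) / (1 - outer_base q l a))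
  * (qpoch q (q ^- l) i * qpoch q (c / a) i * qpoch q (outer_base q l a) i
     / (qpoch q q i * qpoch q (q ^+ 2 / (q ^+ l * q ^+ l * (a * c))) i
        * qpoch q (q ^+ 2 / (q ^+ l * a ^+ 2)) i)).

(** With $b=1/(aq^l)$ the two weights are $(c-b)/((1-c)(a-b))$ and $b(c-a)/((1-c)(a-b))$. *)
Definition outer_left q l (a c : F) : F :=
  (c - (a * q ^+ l)^-1) / ((1 - c) * (a - (a * q ^+ l)^-1)).
Definition outer_right q l (a c : F) : F :=
  (c - a) / (a * q ^+ l * (1 - c) * (a - (a * q ^+ l)^-1)).

Lemma neq0_factor (x y z : F) : x != 0 -> x = y * z -> y != 0.
Proof. by move=> h e; move: h; rewrite e mulf_eq0 negb_or => /andP[]. Qed.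

(** The parameter $aq^{l-i}$ of index $i+1$ at level $l+1$ arises at level $l$ in two ways: from
    $aq$ with index $i+1$, and from $a$ with index $i$. *)
Lemma outer_coef_pascal q l i (a c : F) :
  q != 0 -> a != 0 -> c != 0 -> (i <= l)%N ->
  qpoch q q l.+1 != 0 -> qpoch q c l.+1 != 0 ->
  qpoch q (q ^+ 2 / (q ^+ l.+1 * q ^+ l.+1 * (a * c))) l.+1 != 0 ->
  (forall s, (s <= 2 * l.+1)%N -> 1 - outer_base q l.+1 a * q ^+ s != 0) ->
  outer_coef q l.+1 i.+1 a c
  = outer_left q l a c * outer_coef q l i.+1 (a * q) (c * q)
    + outer_right q l a c * outer_coef q l i a (c * q).
Proof.
move=> q0 a0 c0 hi hq hc hD hA.
have L0 := expf_neq0 l q0.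
have l1 : (l.+1 <= 2 * l.+1)%N by rewrite leq_pmull.
have l2 : (l.+2 <= 2 * l.+1)%N by rewrite mul2n -addnn addSn ltnS leq_addl.
rewrite /outer_coef /outer_left /outer_right.
set L := q ^+ l in L0 *.
(* All bases are written through that of level [l.+1]: it is unchanged when [a] is raised and
   multiplied by [q ^+ 2] when [a] is kept. *)
have -> : outer_base q l (a * q) = outer_base q l.+1 a.
  by rewrite /outer_base [q ^+ l.+1]exprS -/L; field; nz.
have -> : outer_base q l a = outer_base q l.+1 a * q * q.
  by rewrite /outer_base [q ^+ l.+1]exprS -/L; field; nz.
have AE : outer_base q l.+1 a = (q * (L * L) * a ^+ 2)^-1.
  by rewrite /outer_base [q ^+ l.+1]exprS -/L; field; nz.
move: (outer_base q l.+1 a) AE hA => A AE hA.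
rewrite ![q ^+ l.+1]exprS -/L in hD *.
have -> : q * L / q = L by field.
have -> : L / q * (a * q) * (c * q) = L * a * c * q by field.
have -> : L / q * a * (c * q) = L * a * c by field.
have -> : L / q * (a * q) ^+ 2 = L * a ^+ 2 * q by field.
have -> : c * q / (a * q) = c / a by field; nz.
have -> : c * q / a = c / a * q by field.
have DE : q ^+ 2 / (q * L * (q * L) * (a * c)) = (L * L * (a * c))^-1 by field; nz.
rewrite DE in hD *.
have -> : q ^+ 2 / (L * L * (a * q * (c * q))) = (L * L * (a * c))^-1 by field; nz.
have -> : q ^+ 2 / (L * L * (a * (c * q))) = (L * L * (a * c))^-1 * q by field; nz.
have -> : q ^+ 2 / (q * L * a ^+ 2) = (L * a ^+ 2)^-1 * q by field; nz.
have -> : q ^+ 2 / (L * (a * q) ^+ 2) = (L * a ^+ 2)^-1 by field; nz.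
have -> : q ^+ 2 / (L * a ^+ 2) = (L * a ^+ 2)^-1 * q * q by field; nz.
have nA s : (s <= 2 * l.+1)%N -> q * (L * L) * a ^+ 2 - q ^+ s != 0.
  move=> /hA; rewrite AE [_^-1 * _]mulrC; apply: subr1_div_neq0.
  by nz.
have nA0 : 1 - A != 0 by have := hA 0%N isT; rewrite mulr1.
have nA1 : 1 - A * q != 0 by have := hA 1%N isT; rewrite expr1.
(* The denominators in $a^2$ are nonzero by suitable choices of [s] in [nA]: here [s = l.+1], in
   [nb2] [s = 2]. *)
have nb' : 1 - L * a ^+ 2 != 0.
  have := nA _ l1; rewrite [q ^+ _]exprS -/L.
  have -> : q * (L * L) * a ^+ 2 - q * L = - (q * L) * (1 - L * a ^+ 2) by ring.
  by rewrite mulf_eq0 negb_or => /andP[].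
have nb2 : 1 - L / q * a ^+ 2 * L != 0.
  have := nA 2%N; rewrite mulnS => /(_ isT).
  have -> : q * (L * L) * a ^+ 2 - q ^+ 2 = - (q * q) * (1 - L / q * a ^+ 2 * L) by field.
  by rewrite mulf_eq0 negb_or => /andP[].
have nE : a ^+ 2 * L - 1 != 0 by rewrite -opprB oppr_eq0 mulrC.
have nac : 1 - L * a * c != 0.
  move/qpoch_neq0P: hD => /(_ l (leqnn _)); rewrite -/L.
  have -> : 1 - (L * L * (a * c))^-1 * L = - (1 - L * a * c) / (L * a * c) by field; nz.
  by rewrite !mulf_eq0 !negb_or oppr_eq0 => /andP[].
have Sb : qpoch q (L / q * a ^+ 2) l = qpoch q (L * a ^+ 2) l * (1 - L / q * a ^+ 2) / (1 -
    L / q * a ^+ 2 * L).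
  have : (1 - L / q * a ^+ 2) * qpoch q (L * a ^+ 2) l = qpoch q (L / q * a ^+ 2) l * (1 -
      L / q * a ^+ 2 * L).
    rewrite /L -qpochSr qpochSl; congr (_ * qpoch _ _ _); by field.
  by move=> E; rewrite [_ * (1 - L / q * _)]mulrC E mulfK.
rewrite Sb (qpoch_shift q l nac) (qpoch_shift q l nb') -/L.
rewrite (qpoch_shift q i nA1).
rewrite [qpoch q (L * a * c) _]qpochSr [qpoch q (L * a ^+ 2) _]qpochSr -/L.
rewrite [qpoch q c _]qpochSl [qpoch q (c / a) _]qpochSl [qpoch q A _]qpochSl.
rewrite [qpoch q (L * L * (a * c))^-1 _]qpochSl.
rewrite [qpoch q q _]qpochSr.
rewrite [qpoch q (L * a ^+ 2)^-1 _]qpochSl.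
have nEi : 1 - (L * a ^+ 2)^-1 * q != 0.
  have := hA _ l2; rewrite ![q ^+ _.+1]exprS -/L AE.
  by have -> : (q * (L * L) * a ^+ 2)^-1 * (q * (q * L)) = (L * a ^+ 2)^-1 * q by field; nz.
rewrite (qpoch_shift q i nEi) [qpoch q ((L * a ^+ 2)^-1 * q) i.+1]qpochSr.
rewrite [qpoch q (L^-1) i.+1]qpochSr.
rewrite [qpoch q _^-1 i.+1]qpochSl.
have -> : (q * L)^-1 * q = L^-1 by field; nz.
rewrite [(q / c) ^+ i.+1]exprS.
have -> : (q / (c * q)) ^+ i.+1 = (q / c) ^+ i.+1 / (q * q ^+ i).
  by rewrite -exprS -expr_div_n; congr (_ ^+ _); field; nz.
have -> : (q / (c * q)) ^+ i = (q / c) ^+ i / q ^+ i.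
  by rewrite -expr_div_n; congr (_ ^+ _); field; nz.
rewrite ![_ ^+ i.+1]exprS.
have qi0 := expf_neq0 i q0.
move: ((q / c) ^+ i) => Z.
have hqi := qpoch_neq0_le (leq_trans hi (leqnSn l)) hq.
have/qpoch_neq0P/(_ i) hqi' := hq; have {}hqi' := hqi' hi.
have hDi : qpoch q (L * L * (a * c))^-1 i.+1 != 0 by apply: qpoch_neq0_le hD.
move: hDi; rewrite qpochSl mulf_eq0 negb_or => /andP[hD1 hD2].
move: hc; rewrite qpochSl mulf_eq0 negb_or => /andP[hc1 hc2].
have hLa r : (r <= l)%N -> 1 - L * a ^+ 2 * q ^+ r != 0.
  move=> hr; have := nA (l - r).+1; rewrite (leq_trans _ l1) ?ltnS ?leq_subr // => /(_ isT).
  have E : q * L = q ^+ (l - r).+1 * q ^+ r by rewrite -exprD addSn subnK // exprS.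
  move/(mulf_neq0 (expf_neq0 r q0)).
  have -> : q ^+ r * (q * (L * L) * a ^+ 2 - q ^+ (l - r).+1)
     = - (q * L) * (1 - L * a ^+ 2 * q ^+ r) by rewrite mulrBr [q ^+ r * q ^+ _]mulrC -E; ring.
  by rewrite mulf_eq0 negb_or => /andP[].
have hE r : (r <= l)%N -> 1 - (L * a ^+ 2)^-1 * q * q ^+ r != 0.
  move=> hr; have := nA (l + r).+2; rewrite mul2n -addnn addSn addnS !ltnS leq_add2l hr =>
      /(_ isT).
  rewrite [q ^+ _.+2]exprS [q ^+ _.+1]exprS exprD -/L.
  have -> : q * (L * L) * a ^+ 2 - q * (q * (L * q ^+ r))
     = q * (L * L) * a ^+ 2 * (1 - (L * a ^+ 2)^-1 * q * q ^+ r) by field; nz.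
  by rewrite mulf_eq0 negb_or => /andP[].
have hLal : qpoch q (L * a ^+ 2) l != 0 by apply/qpoch_neq0P => r hr; apply/hLa/ltnW.
have hEi : qpoch q ((L * a ^+ 2)^-1 * q) i != 0.
  by apply/qpoch_neq0P => r hr; apply/hE/ltnW/(leq_trans hr).
have := hLa l (leqnn _); have := hE i hi; rewrite -/L.
have nA2 : 1 - A * q * q != 0 by have := hA 2%N; rewrite mulnS expr2 mulrA; apply.
rewrite AE in nA0 nA1 nA2 *.
clear AE hA nA Sb hD DE hLa hE hi hq l1 l2.
(* Powers and factorials become free variables, so that a rational identity remains. *)
move: (q ^+ i) qi0 hqi' => X X0 hqi'.
move: (qpoch q (L * a ^+ 2) l) hLal => P1 hP1.
move: (qpoch q _ i) hEi => P2 hP2.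
move: (qpoch q _ i) hD2 => P3 hP3.
move=> hX hLL.
move: (qpoch q (c * q) l) hc2 => P4 hP4; move: (qpoch q q i) hqi => P5 hP5.
move: (qpoch q _ l) (qpoch q L^-1 i) => U1 U2.
move: (qpoch q (c / a * q) i) (qpoch q _ i) => U3 U4.
(* The nonvanishing facts are restated with inverses cleared, in the form of the side conditions of
   [field]. *)
have ? : L * a ^+ 2 - q != 0.
  by apply: (neq0_factor (z := (L * a ^+ 2)^-1) nEi); field; nz.
have ? : L * a ^+ 2 - q * X != 0.
  by apply: (neq0_factor (z := (L * a ^+ 2)^-1) hX); field; nz.
have ? : L * L * a ^+ 2 - 1 != 0.
  by apply: (neq0_factor (z := -1) hLL); ring.
have n1 : L * L * a ^+ 2 - q != 0.
  by apply: (neq0_factor (z := - q^-1) nb2); field; nz.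
have ? : q - L * a ^+ 2 * L != 0.
  by apply: (neq0_factor (z := -1) n1); ring.
have ? : q - L * a ^+ 2 != 0 by rewrite -opprB oppr_eq0.
have ? : a * (a * L) - 1 != 0.
  by apply: (neq0_factor (z := 1) nE); ring.
have ? : L * L * (a * c) - 1 != 0.
  by apply: (neq0_factor (z := (L * L * (a * c))^-1) hD1); field; nz.
have ? : q * (L * L) * a ^+ 2 - 1 != 0.
  by apply: (neq0_factor (z := (q * (L * L) * a ^+ 2)^-1) nA0); field; nz.
field.
by nz.
Qed.

Lemma outer_coef0_pascal q l (a c : F) :
  q != 0 -> a != 0 -> c != 0 ->
  qpoch q c l.+1 != 0 -> qpoch q (q ^+ l * a ^+ 2) l.+1 != 0 ->
  outer_coef q l.+1 0 a c
  = outer_left q l a c * outer_coef q l 0 (a * q) (c * q).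
Proof.
move=> q0 a0 c0 hc hb.
have L0 := expf_neq0 l q0.
rewrite /outer_coef /outer_left.
have -> : outer_base q l (a * q) = outer_base q l.+1 a.
  by rewrite /outer_base [q ^+ l.+1]exprS; field; nz.
rewrite !qpoch0 [q ^+ l.+1]exprS in hb *.
move: (outer_base q l.+1 a) => A; move: (_ / (1 - A)) => T.
set L := q ^+ l in L0 hb *.
have -> : q * L / q = L by field.
have -> : L / q * (a * q) * (c * q) = L * a * c * q by field.
have -> : L / q * (a * q) ^+ 2 = L * a ^+ 2 * q by field.
move: hb hc; rewrite !qpochSl !mulf_eq0 !negb_or.
move=> /andP[? ?] /andP[? ?].
have nE : a * (a * L) - 1 != 0.
  by apply: (neq0_factor (z := -1) (x := 1 - L * a ^+ 2)) => //; ring.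
rewrite !expr0; field.
by nz; rewrite oner_neq0.
Qed.

(** With $b=1/(aq^l)$, this rests on $(c-b)(1-aq^k)-(c-a)(1-bq^k)=(a-b)(1-cq^k)$. *)
Lemma outer_step q l k (a c : F) :
  q != 0 -> a != 0 -> 1 - c != 0 -> 1 - c * q ^+ k != 0 -> qpoch q c k != 0 ->
  1 - q ^+ l * a ^+ 2 != 0 ->
  qpoch q a k * qpoch q (q / (q ^+ l.+1 * a)) k / qpoch q c k
  = (1 - a) * outer_left q l a c
    * (qpoch q (a * q) k * qpoch q (q / (q ^+ l * (a * q))) k / qpoch q (c * q) k)
  + (1 - a * q ^+ l) * outer_right q l a c
    * (qpoch q a k * qpoch q (q / (q ^+ l * a)) k / qpoch q (c * q) k).
Proof.
move=> q0 a0 c0 ck hck ab.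
have L0 := expf_neq0 l q0.
rewrite (qpoch_shift q k c0) /outer_left /outer_right [q ^+ l.+1]exprS.
set L := q ^+ l in L0 ab *.
have ? : a * (a * L) - 1 != 0 by apply: (neq0_factor (z := -1) ab); ring.
set b := (a * L)^-1.
have -> : q / (q * L * a) = b by rewrite /b; field; nz.
have -> : q / (L * (a * q)) = b by rewrite /b; field; nz.
have -> : q / (L * a) = b * q by rewrite /b; field; nz.
have E1 : (1 - a) * qpoch q (a * q) k = qpoch q a k * (1 - a * q ^+ k).
  by rewrite -qpochSl qpochSr.
have E2 : (1 - b) * qpoch q (b * q) k = qpoch q b k * (1 - b * q ^+ k).
  by rewrite -qpochSl qpochSr.
have -> : 1 - a * L = - (a * L) * (1 - b) by rewrite /b; field; nz.
transitivity ((c - b) / ((1 - c) * (a - b)) * (((1 - a) * qpoch q (a * q) k) * qpoch q b k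
     / (qpoch q c k * (1 - c * q ^+ k) / (1 - c)))
  + - (a * L) * (c - a) / (a * L * (1 - c) * (a - b)) * (qpoch q a k * ((1 - b) * qpoch q
      (b * q) k)
     / (qpoch q c k * (1 - c * q ^+ k) / (1 - c)))).
  by rewrite E1 E2 /b; field; nz.
by ring.
Qed.

(** The coefficients do not depend on [k], so the expansion can be applied termwise inside the
    ${}_4\phi_3$. Each step raises [c] in both branches, hence the common lower parameter
    [c * q ^+ l]. *)
Lemma outer_expand q l k (a c : F) :
  q != 0 -> a != 0 -> c != 0 ->
  qpoch q q l != 0 -> qpoch q c (l + k) != 0 ->
  qpoch q (q ^+ 2 / (q ^+ l * q ^+ l * (a * c))) l != 0 ->
  (forall s, (s <= 2 * l)%N -> 1 - outer_base q l a * q ^+ s != 0) ->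
  qpoch q a k * qpoch q (q / (q ^+ l * a)) k / qpoch q c k
  = qpoch q a l * \sum_(i < l.+1) outer_coef q l i a c
     * (qpoch q (a * q ^+ (l - i)) k * qpoch q (q ^+ i.+1 / (q ^+ l * a)) k
        / qpoch q (c * q ^+ l) k).
Proof.
move=> q0; elim: l a c => [|l IHl] a c a0 c0 hq hc hD hA.
  rewrite big_ord_recl big_ord0 /outer_coef !qpoch0 !expr0 !mulr1 addr0.
  have := hA 0%N isT; rewrite mulr1 => hA0.
  by rewrite !divff ?oner_neq0 // !mul1r expr1.
have L0 := expf_neq0 l q0.
have aq0 := mulf_neq0 a0 q0; have cq0 := mulf_neq0 c0 q0.
have hAq : forall s, (s <= 2 * l)%N -> 1 - outer_base q l (a * q) * q ^+ s != 0.
  move=> s hs; have -> : outer_base q l (a * q) = outer_base q l.+1 a.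
    by rewrite /outer_base [q ^+ l.+1]exprS; field; nz.
  by apply: hA; rewrite (leq_trans hs) // leq_mul2l leqnSn.
(* Keeping [a] multiplies the base by [q ^+ 2]; the shifted range of [s] still ends at
   [2 * l.+1]. *)
have hAr : forall s, (s <= 2 * l)%N -> 1 - outer_base q l a * q ^+ s != 0.
  move=> s hs; have -> : outer_base q l a * q ^+ s = outer_base q l.+1 a * q ^+ s.+2.
    by rewrite /outer_base [q ^+ l.+1]exprS [q ^+ s.+2]exprS [q ^+ s.+1]exprS; field; nz.
  by apply: hA; rewrite mulnS !ltnS.
have hDq : qpoch q (q ^+ 2 / (q ^+ l * q ^+ l * (a * q * (c * q)))) l != 0.
  have -> : q ^+ 2 / (q ^+ l * q ^+ l * (a * q * (c * q))) = q ^+ 2 / (q ^+ l.+1 * q ^+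
      l.+1 * (a * c)).
    by rewrite [q ^+ l.+1]exprS; field; nz.
  exact: qpoch_neq0_le hD.
have hDr : qpoch q (q ^+ 2 / (q ^+ l * q ^+ l * (a * (c * q)))) l != 0.
  have -> : q ^+ 2 / (q ^+ l * q ^+ l * (a * (c * q))) = q ^+ 2 / (q ^+ l.+1 * q ^+ l.+1 *
      (a * c)) * q.
    by rewrite [q ^+ l.+1]exprS; field; nz.
  by move: hD; rewrite qpochSl mulf_eq0 negb_or => /andP[].
have hql : qpoch q q l != 0 by apply: qpoch_neq0_le hq.
have hcq : qpoch q (c * q) (l + k) != 0.
  by move: hc; rewrite addSn qpochSl mulf_eq0 negb_or => /andP[].
have l1 : (l.+1 <= 2 * l.+1)%N by rewrite leq_pmull.
have hb r : (r <= l)%N -> 1 - q ^+ l * a ^+ 2 * q ^+ r != 0.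
  move=> hr; have := hA (l - r).+1; rewrite (leq_trans _ l1) ?ltnS ?leq_subr // => /(_ isT).
  have E : q ^+ l.+1 = q ^+ (l - r).+1 * q ^+ r by rewrite -exprD addSn subnK.
  have qr0 := expf_neq0 r q0; have qs0 := expf_neq0 (l - r).+1 q0.
  have E' : q ^+ l = q ^+ (l - r).+1 * q ^+ r / q by rewrite -E exprS; field.
  move/(neq0_factor (z := - (q * q ^+ (l - r).+1) / (q ^+ l.+1 * q ^+ l.+1 * a ^+ 2))); apply.
  rewrite /outer_base E E'; move: (q ^+ _.+1) (q ^+ r) qs0 qr0 => ? ? ? ?.
  by field; nz.
rewrite outer_step //; first last.
- by have := hb 0%N isT; rewrite mulr1.
- by apply: qpoch_neq0_le hc; rewrite leq_addl.
- by move/qpoch_neq0P: hc => -> //; rewrite addSn ltnS leq_addl.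
- by move/qpoch_neq0P: hc => /(_ 0%N isT); rewrite mulr1.
rewrite (IHl (a * q)) // (IHl a) //.
transitivity (qpoch q a l.+1 * (
   \sum_(i < l.+2) outer_left q l a c * outer_coef q l i (a * q) (c * q)
     * (qpoch q (a * q ^+ (l.+1 - i)) k * qpoch q (q ^+ i.+1 / (q ^+ l.+1 * a)) k
        / qpoch q (c * q ^+ l.+1) k)
   + \sum_(i < l.+1) outer_right q l a c * outer_coef q l i a (c * q)
     * (qpoch q (a * q ^+ (l.+1 - i.+1)) k * qpoch q (q ^+ i.+2 / (q ^+ l.+1 * a)) k
        / qpoch q (c * q ^+ l.+1) k))); first last.
  congr (_ * _).
  rewrite [in RHS]big_ord_recl [X in X + _]big_ord_recl -addrA -big_split /=.
  congr (_ + _).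
    rewrite outer_coef0_pascal //.
      by apply: qpoch_neq0_le hc; rewrite leq_addr.
    by apply/qpoch_neq0P => r hr; apply: hb.
  rewrite -big_split; apply: eq_bigr => i _; rewrite /bump /= add1n [in
      RHS]outer_coef_pascal ?mulrDl //.
  - by rewrite -ltnS.
  - by apply: qpoch_neq0_le hc; rewrite leq_addr.
rewrite [X in _ = _ * (X + _)]big_ord_recr /=.
(* The term added to equalise the ranges is zero because $(q^{-l};q)_{l+1}=0$. *)
have -> : outer_coef q l l.+1 (a * q) (c * q) = 0.
  by rewrite /outer_coef [qpoch q (q ^- l) _]qpochSr mulVf // subrr !(mulr0, mul0r).
rewrite mulr0 mul0r addr0 mulrDr; congr (_ + _).
  rewrite [X in _ = _ * X](eq_bigr (fun i : 'I_l.+1 => outer_left q l a c * (outer_coef q l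
      i (a * q) (c * q)
     * (qpoch q (a * q * q ^+ (l - i)) k * qpoch q (q ^+ i.+1 / (q ^+ l * (a * q))) k
        / qpoch q (c * q * q ^+ l) k)))).
    by rewrite -mulr_sumr qpochSl; ring.
  move=> i _; have hi : (i <= l)%N by rewrite -ltnS.
  move: (outer_left _ _ _ _) (outer_coef _ _ _ _ _) => U V.
  rewrite subSn // -!mulrA -!exprS.
  by have -> : q ^+ l * (a * q) = q ^+ l.+1 * a by rewrite [q ^+ l.+1]exprS; ring.
rewrite [X in _ = _ * X](eq_bigr (fun i : 'I_l.+1 => outer_right q l a c * (outer_coef q l
    i a (c * q)
     * (qpoch q (a * q ^+ (l - i)) k * qpoch q (q ^+ i.+1 / (q ^+ l * a)) k
        / qpoch q (c * q * q ^+ l) k)))).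
  by rewrite -mulr_sumr qpochSr; ring.
move=> i _; move: (outer_right _ _ _ _) (outer_coef _ _ _ _ _) => U V.
have -> : q ^+ i.+2 / (q ^+ l.+1 * a) = q ^+ i.+1 / (q ^+ l * a).
  by rewrite [q ^+ i.+2]exprS [q ^+ l.+1]exprS; field; nz.
by rewrite subSS [q ^+ l.+1]exprS !mulrA.
Qed.

(** * The case $\ell=0$, with parameters $\alpha$ and $\gamma$ *)

Lemma qpoch_rev_ratio q n (u v : F) : q != 0 -> u != 0 -> v != 0 ->
  qpoch q u n * v ^+ n * qpoch q (q / q ^+ n / v) n
  = qpoch q v n * u ^+ n * qpoch q (q / q ^+ n / u) n.
Proof.
move=> q0 u0 v0; rewrite (qpoch_rev q0 u0 (leqnn n)) (qpoch_rev q0 v0 (leqnn n)).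
by rewrite subnn !qpoch0; ring.
Qed.

Lemma add1V_neq0 (x : F) : x != 0 -> 1 + x != 0 -> 1 + x^-1 != 0.
Proof.
move=> x0; have -> : 1 + x = x * (1 + x^-1) by field.
by rewrite mulf_eq0 negb_or => /andP[].
Qed.

Lemma phi43_inner q (al g : F) n m :
  q != 0 -> al != 0 -> g != 0 -> (m <= n)%N ->
  (2%:R != 0 :> F) ->
  (forall e, (0 < e <= 2 * n)%N -> q ^+ e != 1) ->
  qpoch q (- q) n != 0 -> qpoch (q ^+ 2) (g ^+ 2) n != 0 ->
  qpoch q (q ^+ n / q ^+ m * g) n != 0 ->
  phi43 n al (q / al) (q ^- n) (- (q ^+ m / q ^+ n)) g
     (q * q ^+ m / (q ^+ n * q ^+ n * g)) (- q) q q
  = qpoch q (q * q ^+ n / q ^+ m) n * qpoch q (- g) n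
    / (qpoch q (q ^+ n / q ^+ m * g) n * qpoch q (- q) n)
    * \sum_(j < m.+1) inner_term q (g / al) (al * g / q) (q ^- n) (q ^- m) n j.
Proof.
move=> q0 al0 g0 hmn two hq hnq hg he.
have qn0 := expf_neq0 n q0; have qm0 := expf_neq0 m q0.
set x := g / al; set y := al * g / q.
have gE : q * x * y = g ^+ 2 by rewrite /x /y; field; nz.
move: (hg); rewrite -qpoch_sqr mulf_eq0 negb_or => /andP[hg1 hg2].
have hNq e : (0 < e <= n)%N -> 1 + q ^+ e != 0.
  case: e => // e /= he'; move/qpoch_neq0P: hnq => /(_ e he').
  by rewrite mulNr opprK exprS.
(* The choice of [w], [e], [f] makes the given series the left side of [sears]: [y * w] and [x * w]
   are $\alpha$ and $q/\alpha$, and reversal sends [e], [f], [e * f * w] to $q^{1+m-2n}/\gamma$,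
   $-q$, $-q^{m-n}$. *)
set w := q / g; have w0 : w != 0 by rewrite mulf_neq0 ?invr_eq0.
set e := q ^+ n / q ^+ m * g; have e0 : e != 0 by rewrite !mulf_neq0 ?invr_eq0.
set f := - q ^- n; have f0 : f != 0 by rewrite /f oppr_eq0 invr_eq0.
have efw : e * f * w = - (q / q ^+ m) by rewrite /e /f /w; field; nz.
have xyw : x * y * w = g by rewrite /x /y /w; field; nz.
have QQ : q / q ^+ n / q = q ^- n by field; nz.
have Qe : q / q ^+ n / e = q * q ^+ m / (q ^+ n * q ^+ n * g) by rewrite /e; field; nz.
have Qf : q / q ^+ n / f = - q by rewrite /f invrN mulrN invrK divfK.
have Qefw : q / q ^+ n / (- (q / q ^+ m)) = - (q ^+ m / q ^+ n) by field; nz.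
have Qfw : q / q ^+ n / (f * w) = - g by rewrite /f /w; field; nz.
have Qew : q / q ^+ n / (e * w) = q ^+ m / (q ^+ n * q ^+ n) by rewrite /e /w; field; nz.
have hqn : qpoch q q n != 0 by apply: (qpoch_self_neq0 hq); rewrite leq_pmull.
have hefw : qpoch q (- (q / q ^+ m)) n != 0.
  apply/qpoch_neq0P => r hr.
  (* The factor is $1+q^{r+1-m}$, with an exponent of either sign; exponent 0 gives 2, whence the
     hypothesis [two]. *)
  case: (leqP r.+1 m) => hrm.
    case: (eqVneq r.+1 m) => [rm|rm].
      by rewrite -rm exprS; have -> : 1 - - (q / (q * q ^+ r)) * q ^+ r = 2%:R by field;
          rewrite q0 expf_neq0.
    have -> : 1 - - (q / q ^+ m) * q ^+ r = 1 + (q ^+ (m - r.+1))^-1.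
      rewrite -{1}(subnK hrm) exprD exprS; move: (expf_neq0 (m - r.+1) q0) (expf_neq0 r q0).
      by move: (q ^+ _) (q ^+ _) => ? ? ? ?; field; nz.
    apply: add1V_neq0; first by rewrite expf_neq0.
    by apply: hNq; rewrite subn_gt0 ltn_neqAle rm hrm (leq_trans (leq_subr _ _)).
  have -> : 1 - - (q / q ^+ m) * q ^+ r = 1 + q ^+ (r - m).+1.
    by rewrite -{1}(subnK (hrm : (m <= r)%N)) exprD exprS; field.
  by apply: hNq; rewrite /= (leq_ltn_trans (leq_subr _ _)).
have hf : qpoch q f n != 0.
  apply/qpoch_neq0P => r hr.
  rewrite /f mulNr opprK exprN_mul // ?(ltnW hr) //.
  apply: add1V_neq0; first by rewrite expf_neq0.
  by apply: hNq; rewrite subn_gt0 hr leq_subr.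
have ewE : e * w = q * q ^+ n / q ^+ m by rewrite /e /w; field; nz.
have hew : qpoch q (e * w) n != 0.
  apply/qpoch_neq0P => r hr.
  have -> : 1 - e * w * q ^+ r = 1 - q ^+ (n - m + r).+1.
    by rewrite ewE -{1}(subnK hmn) exprD exprS exprD; field.
  rewrite subr_eq0 eq_sym hq //= mul2n -addnn -addnS leq_add ?leq_subr //.
(* Reversing both factorials turns the prefactor $(fw;q)_n/(w^n(f;q)_n)$ of [sears] into
   $(-\gamma;q)_n/(-q;q)_n$. *)
have rel : qpoch q (f * w) n * qpoch q (- q) n = qpoch q f n * w ^+ n * qpoch q (- g) n.
  have := qpoch_rev_ratio n q0 (mulf_neq0 f0 w0) f0; rewrite Qf Qfw exprMn => E.
  by apply: (mulIf (expf_neq0 n f0)); rewrite mulrAC E; ring.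
have hfw : qpoch q (f * w) n != 0.
  have : qpoch q f n * w ^+ n * qpoch q (- g) n != 0 by rewrite !mulf_neq0 ?expf_neq0.
  by rewrite -rel mulf_eq0 negb_or => /andP[].
have := @sears q x y w e f n q0 e0 f0 w0 hqn.
rewrite xyw efw => /(_ hg1 hefw he hf hew hfw) /=.
rewrite QQ Qe Qf Qefw Qfw Qew.
have -> : y * w = al by rewrite /y /w; field; nz.
have -> : x * w = q / al by rewrite /x /w; field; nz.
rewrite -/(phi43 n al (q / al) (q ^- n) (- (q ^+ m / q ^+ n)) g (q * q ^+ m / (q ^+ n * q
    ^+ n * g)) (- q) q q).
rewrite -sears_sum_expand ?gE //.
rewrite (eq_bigr (fun k : 'I_n.+1 => sears_term q x y (q ^- n) (q ^- m) k)); last first.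
  move=> k _; rewrite /sears_term !qpochsE gE -qpoch_sqr.
  have -> : q ^- n / q ^- m = q ^+ m / q ^+ n by field; nz.
  have -> : (q ^- n) ^+ 2 / q ^- m = q ^+ m / (q ^+ n * q ^+ n) by field; nz.
  by congr (_ / _ * _); rewrite ?mulrA //; ring.
move: (phi43 _ _ _ _ _ _ _ _ _ _) (\sum_(k < _) _) => P S E.
apply: (mulfI (mulf_neq0 (expf_neq0 n w0) (mulf_neq0 he hf))).
rewrite E -ewE; have -> : qpoch q (f * w) n = qpoch q f n * w ^+ n * qpoch q (- g) n /
    qpoch q (- q) n.
  by rewrite -rel mulfK.
by field; nz.
Qed.

(** * Matching the summand $T_{i,j}$ *)

Lemma exprzB q (m n : nat) : q != 0 -> q ^ (m%:Z - n%:Z) = q ^+ m / q ^+ n.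
Proof. by move=> q0; rewrite expfzDr // exprnN. Qed.

(** The arguments of [inner_term] are $\gamma/\alpha$ and $\alpha\gamma/q$ at $\alpha=aq^{l-i}$,
    $\gamma=q^lc$. *)
Lemma qterm_factor q (a c : F) l m n i j :
  q != 0 -> a != 0 -> c != 0 -> (i <= l)%N ->
  qpoch q a l * outer_coef q l i a c
    * inner_term q (q ^+ i * c / a) (q ^+ l * q ^+ l / (q ^+ i * q) * a * c)
        (q ^- n) (q ^- m) n j
  = qpochs q [:: a; q ^ (l%:Z - 1) * a * c] l
    / qpochs q [:: c; q ^ (l%:Z - 1) * a ^+ 2] l * qterm q a c l m n i j.
Proof.
move=> q0 a0 c0 hi.
have L0 := expf_neq0 l q0; have I0 := expf_neq0 i q0.
have J0 := expf_neq0 j q0; have N0 := expf_neq0 n q0; have M0 := expf_neq0 m q0.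
have dbl k : q ^+ (2 * k) = q ^+ k * q ^+ k by rewrite mul2n -addnn exprD.
(* Integer powers become quotients of natural powers, the form in which the preceding lemmas are
   stated. *)
have e1 : q ^ (l%:Z - 1) = q ^+ l / q by rewrite -[1]/(1%:Z) exprzB.
have e2 : q ^ (i%:Z + (m%:Z - n%:Z) * j%:Z + 'C(j.+1, 2)%:Z)
    = q ^+ i * (q ^+ m / q ^+ n) ^+ j * q ^+ 'C(j.+1, 2).
  by rewrite !expfzDr // -exprz_exp exprzB.
have e3 : q ^ (1 - 2 * l%:Z + 2 * i%:Z) = q * (q ^+ i * q ^+ i) / (q ^+ l * q ^+ l).
  have -> : 1 - 2 * l%:Z + 2 * i%:Z = (2 * i).+1%:Z - (2 * l)%N%:Z by lia.
  by rewrite exprzB // exprS !dbl.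
have e4 : q ^ (1 - 2 * l%:Z) = q / (q ^+ l * q ^+ l).
  have -> : 1 - 2 * l%:Z = 1%N%:Z - (2 * l)%N%:Z by lia.
  by rewrite exprzB // dbl.
have e5 (k : nat) : q ^ (- k%:Z) = q ^- k by rewrite exprnN.
have e6 : q ^ (2 - 2 * l%:Z) = q ^+ 2 / (q ^+ l * q ^+ l).
  have -> : 2 - 2 * l%:Z = 2%N%:Z - (2 * l)%N%:Z by lia.
  by rewrite exprzB // dbl.
have e7 : q ^ (2 - l%:Z) = q ^+ 2 / q ^+ l.
  by rewrite -[2]/(2%N%:Z) exprzB.
have e8 : q ^ (2 * l%:Z - i%:Z - 1) = q ^+ l * q ^+ l / (q ^+ i * q).
  have -> : 2 * l%:Z - i%:Z - 1 = (2 * l)%N%:Z - i.+1%:Z by lia.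
  by rewrite exprzB // dbl exprSr.
have e9 : q ^ (m%:Z - 2 * n%:Z) = q ^+ m / (q ^+ n * q ^+ n).
  have -> : m%:Z - 2 * n%:Z = m%:Z - (2 * n)%N%:Z by lia.
  by rewrite exprzB // dbl.
have e10 : q ^ (j%:Z - 2 * n%:Z - 1) = q ^+ j / (q ^+ n * q ^+ n * q).
  have -> : j%:Z - 2 * n%:Z - 1 = j%:Z - (2 * n).+1%:Z by lia.
  by rewrite exprzB // exprSr dbl.
have e11 : q ^ (2 * l%:Z - i%:Z + j%:Z) = q ^+ l * q ^+ l * q ^+ j / q ^+ i.
  have -> : 2 * l%:Z - i%:Z + j%:Z = (2 * l + j)%N%:Z - i%:Z by lia.
  by rewrite exprzB // exprD dbl.
rewrite /qterm e1 e2 e3 e4 !e5 e6 e7 e8 e9 e10 e11 !qpochsE.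
rewrite /outer_coef /inner_term /qwatson_tail /outer_base.
have gE : q * (q ^+ i * c / a) * (q ^+ l * q ^+ l / (q ^+ i * q) * a * c) = (q ^+ l * c) ^+ 2.
  by field; nz.
rewrite gE -qpoch_sqr.
have -> : q ^+ (2 * j) * (q ^+ l * c) ^+ 2 = q ^+ (2 * l + 2 * j) * c ^+ 2.
  by rewrite exprD !dbl; ring.
have -> : q ^+ j.+1 * (q ^+ i * c / a) = q ^+ (1 + i + j) * c / a.
  by rewrite !exprD exprS; field.
have -> : q ^+ j.+1 * (q ^+ l * q ^+ l / (q ^+ i * q) * a * c)
    = q ^+ l * q ^+ l * q ^+ j / q ^+ i * a * c.
  by rewrite exprS; field; nz.
have -> : q ^- n / q ^- m = q ^+ m / q ^+ n by field; nz.
have -> : (q ^- n) ^+ 2 / q ^- m = q ^+ m / (q ^+ n * q ^+ n) by field; nz.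
have -> : (q ^- n) ^+ 2 * q ^+ j / q = q ^+ j / (q ^+ n * q ^+ n * q) by field; nz.
have -> : q / (q ^+ l * q ^+ l) / a ^+ 2 = q / (q ^+ l * q ^+ l * a ^+ 2) by field; nz.
have -> : q ^+ 2 / (q ^+ l * q ^+ l) / (a * c) = q ^+ 2 / (q ^+ l * q ^+ l * (a * c)) by
    field; nz.
have -> : q ^+ 2 / q ^+ l / a ^+ 2 = q ^+ 2 / (q ^+ l * a ^+ 2) by field; nz.
have -> : q * (q ^+ i * q ^+ i) / (q ^+ l * q ^+ l) / a ^+ 2
    = q / (q ^+ l * q ^+ l * a ^+ 2) * (q ^+ i * q ^+ i) by field; nz.
rewrite expr_div_n mulNr !invfM.
by ring.
Qed.

End QSeries.

(** * Extracting the nonvanishing conditions and assembling the double sum *)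

Theorem mainTheorem15 (R : realType) (q a c : R[i]) (l m n : nat)
  (hq : q != 0) (ha : a != 0) (hc : c != 0) (hmn : (m <= n)%N)
  (* no zero factor in a denominator of the left-hand side *)
  (hL : forall k : nat, (k <= n)%N ->
     qpochs q [:: q; c; q ^ (1 - l%:Z + m%:Z - 2 * n%:Z) / c; - q] k != 0)
  (* no zero factor in a denominator of the prefactor *)
  (hP1 : qpochs q [:: c; q ^ (l%:Z - 1) * a ^+ 2] l != 0)
  (hP2 : qpochs q [:: q ^ (n%:Z - m%:Z + l%:Z) * c; - q] n != 0)
  (* no zero factor in a denominator of a summand *)
  (hT1 : 1 - q ^ (1 - 2 * l%:Z) / a ^+ 2 != 0)
  (hT2 : forall i : nat, (i <= l)%N ->
     qpochs q [:: q; q ^ (2 - 2 * l%:Z) / (a * c);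
                  q ^ (2 - l%:Z) / a ^+ 2] i != 0)
  (hT3 : forall j : nat, (j <= m)%N ->
     qpochs q [:: q; q ^+ l * c; - q ^+ l * c; q ^ (m%:Z - 2 * n%:Z);
                  q ^ (j%:Z - 2 * n%:Z - 1)] j != 0)
  (hT4 : forall j : nat, (j <= m)%N ->
     qpochs (q ^+ 2) [:: q; q ^+ (2 * l + 2 * j) * c ^+ 2] (n - j) != 0) :
  phi43 n a (q ^ (1 - l%:Z) / a) (q ^ (- n%:Z)) (- q ^ (m%:Z - n%:Z))
          c (q ^ (1 - l%:Z + m%:Z - 2 * n%:Z) / c) (- q) q q
  = (qpochs q [:: a; q ^ (l%:Z - 1) * a * c] l
     / qpochs q [:: c; q ^ (l%:Z - 1) * a ^+ 2] l)
    * (qpochs q [:: q ^ (1 - m%:Z + n%:Z); - q ^+ l * c] n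
       / qpochs q [:: q ^ (n%:Z - m%:Z + l%:Z) * c; - q] n)
    * \sum_(i < l.+1) \sum_(j < m.+1) qterm q a c l m n i j.
Proof.
have two : 2%:R != 0 :> R[i] by rewrite Num.Theory.pnatr_eq0.
have L0 := expf_neq0 l hq.
have dbl k : q ^+ (2 * k) = q ^+ k * q ^+ k by rewrite mul2n -addnn exprD.
have e1 : q ^ (l%:Z - 1) = q ^+ l / q by rewrite -[1]/(1%:Z) exprzB.
have e3 : q ^ (1 - 2 * l%:Z) = q / (q ^+ l * q ^+ l).
  have -> : 1 - 2 * l%:Z = 1%N%:Z - (2 * l)%N%:Z by lia.
  by rewrite exprzB // dbl.
have e4 : q ^ (2 - l%:Z) = q ^+ 2 / q ^+ l.
  by rewrite -[2]/(2%N%:Z) exprzB.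
have e5 : q ^ (2 - 2 * l%:Z) = q ^+ 2 / (q ^+ l * q ^+ l).
  have -> : 2 - 2 * l%:Z = 2%N%:Z - (2 * l)%N%:Z by lia.
  by rewrite exprzB // dbl.
have e6 : q ^ (1 - l%:Z) = q / q ^+ l by rewrite -[1]/(1%:Z) exprzB.
have e7 : q ^ (m%:Z - n%:Z) = q ^+ m / q ^+ n by rewrite exprzB.
have e8 : q ^ (n%:Z - m%:Z + l%:Z) = q ^+ n / q ^+ m * q ^+ l.
  by rewrite expfzDr // exprzB.
have e9 : q ^ (1 - l%:Z + m%:Z - 2 * n%:Z) = q * q ^+ m / (q ^+ n * q ^+ n * q ^+ l).
  have -> : 1 - l%:Z + m%:Z - 2 * n%:Z = m.+1%:Z - (2 * n + l)%N%:Z by lia.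
  by rewrite exprzB // exprD dbl exprS.
have e10 : q ^ (1 - m%:Z + n%:Z) = q * q ^+ n / q ^+ m.
  have -> : 1 - m%:Z + n%:Z = n.+1%:Z - m%:Z by lia.
  by rewrite exprzB // exprS.
set g := c * q ^+ l.
have g0 : g != 0 by rewrite mulf_neq0.
have hg : qpoch (q ^+ 2) (g ^+ 2) n != 0.
  have := hT4 0%N isT; rewrite !qpochsE subn0 muln0 addn0 dbl mulf_eq0 negb_or.
  by case/andP=> _; rewrite /g exprMn mulrC.
have hodd : qpoch (q ^+ 2) q n != 0.
  by have := hT4 0%N isT; rewrite !qpochsE subn0 mulf_eq0 negb_or => /andP[].
have [hqn hnq] : qpoch q q n != 0 /\ qpoch q (- q) n != 0.
  have := hL n (leqnn n); rewrite !qpochsE !mulf_eq0 !negb_or.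
  by case/and4P=> -> _ _ ->.
have hq2n e : (0 < e <= 2 * n)%N -> q ^+ e != 1.
  (* Odd exponents are excluded by $(q;q^2)_n\ne0$. For $e=2h$, $q^e=1$ would force $q^h=\pm1$,
     against $(q;q)_n\ne0$ and $(-q;q)_n\ne0$. *)
  rewrite -(odd_double_half e); case: (odd e) => /=.
    rewrite add1n mul2n ltn_double => eh; rewrite exprS -mul2n exprM.
    by move/qpoch_neq0P: hodd => /(_ _ eh); rewrite subr_eq0 eq_sym.
  rewrite add0n double_gt0 mul2n leq_double; case: (e./2) => // h /= eh.
  rewrite -muln2 exprM sqrf_eq1 negb_or; apply/andP; split.
    by move/qpoch_neq0P: hqn => /(_ _ eh); rewrite -exprS subr_eq0 eq_sym.
  move/qpoch_neq0P: hnq => /(_ _ eh).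
  by rewrite mulNr opprK -exprS addrC addr_eq0.
have [hcl hb] : qpoch q c l != 0 /\ qpoch q (q ^+ l / q * a ^+ 2) l != 0.
  by move: hP1; rewrite e1 !qpochsE mulf_eq0 negb_or => /andP.
have he : qpoch q (q ^+ n / q ^+ m * g) n != 0.
  move: hP2; rewrite e8 !qpochsE mulf_eq0 negb_or => /andP[+ _].
  by rewrite /g [c * _]mulrC mulrA.
have [hql hD hA1] : [/\ qpoch q q l != 0, qpoch q (q ^+ 2 / (q ^+ l * q ^+ l * (a * c))) l != 0
    & qpoch q (q ^+ 2 / q ^+ l / a ^+ 2) l != 0].
  have := hT2 l (leqnn l); rewrite e4 e5 !qpochsE !mulf_eq0 !negb_or.
  by case/and3P=> ? ? ?; split; rewrite // invfM mulrA.
have hA s : (s <= 2 * l)%N -> 1 - outer_base q l a * q ^+ s != 0.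
  (* Three sources cover the range: [hT1] for exponent 0, the reciprocal factors of
     $(q^{l-1}a^2;q)_l$ for exponents 1 to $l$, and $(q^{2-l}/a^2;q)_l$ for $l+1$ to $2l$. *)
  rewrite /outer_base => hs; case: s hs => [|s] hs.
    have -> : q / (q ^+ l * q ^+ l * a ^+ 2) = q / (q ^+ l * q ^+ l) / a ^+ 2 by field; nz.
    by move: hT1; rewrite e3 expr0 mulr1.
  case: (ltnP s l) => hsl.
    have hr : (l - s.+1 < l)%N by rewrite ltn_subrL (leq_ltn_trans _ hsl).
    move/qpoch_neq0P: hb => /(_ _ hr).
    move/(neq0_factor (z := - (q ^+ (l - s.+1) * q ^+ l * a ^+ 2 / q))); apply.
    have -> : q ^+ l = q ^+ (l - s.+1) * q ^+ s.+1 by rewrite -exprD subnK.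
    move: (expf_neq0 (l - s.+1) hq) (expf_neq0 s.+1 hq).
    by move: (q ^+ _) (q ^+ _) => T S T0 S0; field; nz.
  have hr : (s - l < l)%N by rewrite -(ltn_add2r l) subnK // addnn -mul2n.
  move/qpoch_neq0P: hA1 => /(_ _ hr).
  have -> // : q ^+ 2 / q ^+ l / a ^+ 2 * q ^+ (s - l) = q / (q ^+ l * q ^+ l * a ^+ 2) * q
      ^+ s.+1.
  have -> : q ^+ s.+1 = q * (q ^+ (s - l) * q ^+ l) by rewrite -exprD subnK // exprS.
  move: (q ^+ (s - l)) => S.
  by field; nz.
have hgk k : (k <= n)%N -> qpoch q g k != 0.
  move=> hk; apply: (qpoch_neq0_le hk); move: hg.
  by rewrite -qpoch_sqr mulf_eq0 negb_or => /andP[].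
pose al i := a * q ^+ (l - i).
have al0 i : al i != 0 by rewrite mulf_neq0 ?expf_neq0.
(* Each [k]-th term is expanded over [i] and the sums are exchanged; the remaining lower parameter
   is already $q^{1+m-2n}/\gamma$, so every inner sum is the series of [phi43_inner]. *)
transitivity (\sum_(i < l.+1) qpoch q a l * outer_coef q l i a c
   * phi43 n (al i) (q / al i) (q ^- n) (- (q ^+ m / q ^+ n)) g
     (q * q ^+ m / (q ^+ n * q ^+ n * g)) (- q) q q).
  rewrite /phi43; under [RHS]eq_bigr => i _ do rewrite mulr_sumr.
  rewrite exchange_big /=; apply: eq_bigr => k _.
  have hk : (k <= n)%N by rewrite -ltnS.
  have hclk : qpoch q c (l + k) != 0 by rewrite qpochD mulf_neq0 ?hgk.
  have := @outer_expand _ q l k a c hq ha hc hql hclk hD hA; rewrite -/g => E.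
  rewrite !qpochsE e6 e7 e9 -exprnN.
  have -> : q / q ^+ l / a = q / (q ^+ l * a) by rewrite invfM mulrA.
  have -> : q * q ^+ m / (q ^+ n * q ^+ n * q ^+ l) / c = q * q ^+ m / (q ^+ n * q ^+ n * g).
    by rewrite /g; field; nz.
  set H := q * q ^+ m / _.
  transitivity (qpoch q a k * qpoch q (q / (q ^+ l * a)) k / qpoch q c k
     * (qpoch q (q ^- n) k * qpoch q (- (q ^+ m / q ^+ n)) k
        / (qpoch q q k * (qpoch q H k * qpoch q (- q) k)) * q ^+ k)).
    by rewrite !invfM; ring.
  rewrite E mulr_sumr mulr_suml; apply: eq_bigr => i _; have hi : (i <= l)%N by rewrite -ltnS.
  have Li : q ^+ l = q ^+ (l - i) * q ^+ i by rewrite -exprD subnK.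
  have -> : q ^+ i.+1 / (q ^+ l * a) = q / al i.
    rewrite /al Li exprS; move: (expf_neq0 (l - i) hq) (expf_neq0 i hq).
    by move: (q ^+ _) (q ^+ _) => T I T0 I0; field; nz.
  rewrite !qpochsE /al !invfM; ring.
rewrite mulr_sumr; apply: eq_bigr => i _; have hi : (i <= l)%N by rewrite -ltnS.
  have Li : q ^+ l = q ^+ (l - i) * q ^+ i by rewrite -exprD subnK.
rewrite phi43_inner // !mulr_sumr; apply: eq_bigr => j _.
have -> : g / al i = q ^+ i * c / a.
  rewrite /g /al Li; move: (expf_neq0 (l - i) hq) (expf_neq0 i hq).
  by move: (q ^+ _) (q ^+ _) => T I T0 I0; field; nz.
have -> : al i * g / q = q ^+ l * q ^+ l / (q ^+ i * q) * a * c.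
  rewrite /g /al Li; move: (expf_neq0 (l - i) hq) (expf_neq0 i hq).
  by move: (q ^+ _) (q ^+ _) => T I T0 I0; field; nz.
rewrite [RHS]mulrAC -qterm_factor //.
move: (outer_coef _ _ _ _ _) (inner_term _ _ _ _ _ _ _) => U V.
rewrite !qpochsE e8 e10.
have -> : - q ^+ l * c = - g by rewrite /g; ring.
have -> : q ^+ n / q ^+ m * q ^+ l * c = q ^+ n / q ^+ m * g by rewrite /g; ring.
by ring.
Qed.
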